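(* Consider the randomized stopped-mass game with payoffs $$J_i^R(p)=\mathbb E\Big[\int_{[0,\infty)}g_i^N(X_t,t,p_t^{-i})\,dp_t^i\Big],\qquad p\in\mathcal R^N,\ i\in[N],$$ where $g_i^N$ is the multi-affine extension of a measurable reward $h_i^N:\mathbb R^d\times[0,\infty)\times\{0,1\}^{N-1}\to\mathbb R$. Fix a deterministic base profile $z\in\mathcal R^N$ and let $$\Phi_z^R(p):=\int_0^1\sum_{i=1}^N\mathbb E\Big[\int_{[0,\infty)}g_i^N\big(X_t,t,\{z_t+r(p_t-z_t)\}^{-i}\big)\,d(p_t^i-z_t^i)\Big]dr,\qquad p\in\mathcal R^N .$$ For distinct $i,j\in[N]$ set $$L_{ij}^N:=\sup_{x\in\mathbb R^d,\ t\ge0,\ a^{-i,j}\in\{0,1\}^{N-2}}\big|h_i^N(x,t,1,a^{-i,j})-h_i^N(x,t,0,a^{-i,j})\big|,$$ where $h_i^N(x,t,b,a^{-i,j})$ denotes $h_i^N$ evaluated with status $b\in\{0,1\}$ for player $j$ and statuses $a^{-i,j}=(a^k)_{k\ne i,j}$ for the remaining opponents of $i$. Let $\alpha_N$ be the smallest constant $\alpha$ such that $\Phi_z^R$ is an $\alpha$-potential function for this randomized game. Then for every integer $N\ge2$, $$\alpha_N\le 2\max_{i\in[N]}\sum_{j\ne i}\big(L_{ij}^N+L_{ji}^N\big).$$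
   Context: Fix $N\ge 2$ and $[N]=\{1,\dots,N\}$. $(\Omega,\mathcal F,\mathbb F,\mathbb P)$ is a filtered probability space satisfying the usual conditions, where $\mathbb F$ is generated by a continuous $\mathbb R^d$-valued process $X=(X_t)_{t\ge0}$. $\mathcal T$ is the set of $\mathbb F$-stopping times $\tau:\Omega\to[0,\infty)$. Standing integrability assumption: $\sup_{\tau\in\mathcal T^N}\mathbb E\big[|h_i^N(X_{\tau^i},\tau^i,(\mathbf 1_{\{\tau^j\le\tau^i\}})_{j\ne i})|\big]<\infty$ for each $i$. $\mathcal R$ is the set of processes $p:[0,\infty)\times\Omega\to[0,1]$ that are $\mathbb F$-adapted, càdlàg, nondecreasing, with $p_{0-}=0$ and $p_\infty=\lim_{t\to\infty}p_t=1$. For a vector $q=(q^1,\dots,q^N)$, $q^{-i}=(q^j)_{j\ne i}$. The multi-affine extension is $$g_i^N(x,t,q^{-i}):=\sum_{a^{-i}\in\{0,1\}^{N-1}}h_i^N(x,t,a^{-i})\prod_{j\ne i}(q^j)^{a^j}(1-q^j)^{1-a^j},\qquad q^{-i}\in[0,1]^{N-1},$$ with $0^0=1$. Integrals over $[0,\infty)$ with respect to $dp^i_t$ include the possible atom at $t=0$ (since $p^i_{0-}=0$). A functional $\Psi:\mathcal R^N\to\mathbb R$ is an $\alpha$-potential function for the randomized game if for every $i\in[N]$, $p\in\mathcal R^N$ and $\widetilde p^i\in\mathcal R$, $$\Big|[J_i^R(\widetilde p^i,p^{-i})-J_i^R(p)]-[\Psi(\widetilde p^i,p^{-i})-\Psi(p)]\Big|\le\alpha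 .$$ *)

(* Defs.v *)
From HB Require Import structures.
From mathcomp Require Export all_boot all_order all_algebra.
From mathcomp Require Export all_classical all_reals all_analysis.

Set Implicit Arguments.
Unset Strict Implicit.
Unset Printing Implicit Defensive.

Import Order.TTheory GRing.Theory Num.Theory.
Import numFieldNormedType.Exports.

Local Open Scope classical_set_scope.
Local Open Scope ring_scope.

(* R^n with its Borel sigma-algebra; convertible to 'rV[R]_n. *)
Notation borel_rV R n := (g_sigma_algebraType (@open 'rV[R]_n)).

(* Time is the half-line [0, +oo): a process is a function of t : R of which
   only the values at t >= 0 are ever constrained or used. *)
Section stochastic_basis.
Context {R : realType} {dis : measure_display} {Omega : measurableType dis}.
Implicit Types (P : probability Omega R) (F : R -> set (set Omega)).

Definition filtration F :=
  [/\ forall t : R, 0 <= t -> sigma_algebra [set: Omega] (F t),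
      forall t : R, 0 <= t -> F t `<=` measurable &
      forall s t : R, 0 <= s -> s <= t -> F s `<=` F t].

Definition right_continuous_filtration F :=
  forall t : R, 0 <= t -> F t = \bigcap_(s in [set s | t < s]) F s.

Definition usual_conditions P F :=
  [/\ measure_is_complete P,
      P.-negligible `<=` F 0 &
      right_continuous_filtration F].

Definition natural_events n (X : R -> Omega -> 'rV[R]_n) (t : R)
    : set (set Omega) :=
  [set A | exists (u : R) (B : set (borel_rV R n)),
     [/\ 0 <= u <= t, measurable B & A = X u @^-1` B]].

(* F is the usual (null-set completed, right-continuous) augmentation of the
   natural filtration of X. *)
Definition generated_by P F n (X : R -> Omega -> 'rV[R]_n) :=
  forall t : R, 0 <= t ->
    F t = \bigcap_(s in [set s | t < s])
            <<s natural_events X s `|` P.-negligible >>.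

Definition continuous_process n (X : R -> Omega -> 'rV[R]_n) :=
  forall w, {within `[0, +oo[%classic, continuous (X ^~ w)}.

Definition stopping_time F (tau : Omega -> R) :=
  (forall w, 0 <= tau w) /\
  (forall t : R, 0 <= t -> F t [set w | tau w <= t]).

Definition adapted F (p : R -> Omega -> R) :=
  forall t : R, 0 <= t -> forall B : set R, measurable B -> F t (p t @^-1` B).

Definition cadlag (f : R -> R) :=
  (forall t : R, 0 <= t -> f x @[x --> t^'+] --> f t) /\
  (forall t : R, 0 < t -> cvg (f x @[x --> t^'-])).

Record randomized_stopping F := RandomizedStopping {
  rs_val :> R -> Omega -> R ;
  rs_itv : forall (t : R) w, 0 <= t -> 0 <= rs_val t w <= 1 ;
  rs_adapted : adapted F rs_val ;
  rs_cadlag : forall w, cadlag (rs_val ^~ w) ;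
  rs_nondecreasing : forall w (s t : R), 0 <= s -> s <= t -> rs_val s w <= rs_val t w ;
  rs_infty : forall w, rs_val t w @[t --> +oo] --> (1 : R) }.

(* The convention p_{0-} = 0: extending the path by 0 on the negative axis
   gives {0} the mass p_0. *)
Definition rs_path F (p : randomized_stopping F) (w : Omega) : R -> R :=
  fun t => if t < 0 then 0 else p t w.

Section rs_path_cumulative.
Context F (p : randomized_stopping F) (w : Omega).

Let rs_path_nd : nondecreasing (rs_path p w).
Proof.
move=> s t st; rewrite /rs_path; case: ltP => s0; case: ltP => t0 //.
- by have /andP[] := rs_itv p w t0.
- by have := le_lt_trans (le_trans s0 st) t0; rewrite ltxx.
- exact: rs_nondecreasing.
Qed.

Let rs_path_rc : right_continuous (rs_path p w).
Proof.
move=> t; rewrite {2}/rs_path; case: ltP => t0.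
  apply: (@cvg_trans _ ((fun=> 0 : R) x @[x --> t^'+])); last exact: cvg_cst.
  apply: near_eq_cvg; near=> x.
  by rewrite /rs_path ifT//; near: x; exact: nbhs_right_lt.
apply: cvg_trans ((rs_cadlag p w).1 _ t0).
apply: near_eq_cvg; near=> x.
rewrite /rs_path ifF//; apply/negbTE; rewrite -leNgt.
by apply: le_trans t0 _; near: x; exact: nbhs_right_ge.
Unshelve. all: by end_near. Qed.

HB.instance Definition _ :=
  isCumulative.Build R _ R (rs_path p w) rs_path_nd rs_path_rc.

End rs_path_cumulative.

Definition path_integral F (p : randomized_stopping F) (w : Omega)
    (f : R -> R) : R :=
  \int[lebesgue_stieltjes_measure (rs_path p w)]_(t in `[0, +oo[) f t.

(* Integral against the signed measure d(p - z). *)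
Definition path_integralB F (p z : randomized_stopping F) (w : Omega)
    (f : R -> R) : R :=
  path_integral p w f - path_integral z w f.

Definition deterministic F (p : randomized_stopping F) :=
  forall (t : R) w w', 0 <= t -> p t w = p t w'.

End stochastic_basis.

Section potential.
Context {R : realType} {N : nat} {S : Type}.
Implicit Types (J : 'I_N -> ('I_N -> S) -> R) (Psi : ('I_N -> S) -> R).

Definition deviate (i : 'I_N) (s : S) (p : 'I_N -> S) : 'I_N -> S :=
  fun j => if j == i then s else p j.

Definition alpha_potential J Psi (alpha : R) :=
  forall (i : 'I_N) (p : 'I_N -> S) (s : S),
    `| (J i (deviate i s p) - J i p) - (Psi (deviate i s p) - Psi p) |
      <= alpha.

Definition smallest_alpha J Psi : \bar R :=
  ereal_inf [set alpha%:E | alpha in alpha_potential J Psi].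

(* The infimum is a minimum as soon as some alpha works (and +oo if none does). *)
Lemma smallest_alpha_min J Psi (i : 'I_N) (p : 'I_N -> S) :
  (exists alpha, alpha_potential J Psi alpha) ->
  exists alpha, [/\ smallest_alpha J Psi = alpha%:E,
    alpha_potential J Psi alpha &
    forall b, alpha_potential J Psi b -> alpha <= b].
Proof.
move=> [b bP].
have lbA : has_lbound (alpha_potential J Psi).
  by exists 0 => c /(_ i p (p i)); exact: le_trans.
exists (inf (alpha_potential J Psi)); split.
- by rewrite /smallest_alpha ereal_inf_EFin//; exists b.
- move=> k q s; apply: lb_le_inf; first by exists b.
  by move=> c; exact.
- by move=> c cP; apply: ge_inf.
Qed.

End potential.

Section game.
Context {R : realType} {N n : nat}.

Definition opponent (i : 'I_N) := {j : 'I_N | j != i}.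
Definition opponent2 (i j : 'I_N) := {k : 'I_N | (k != i) && (k != j)}.

Definition reward :=
  forall i : 'I_N, 'rV[R]_n -> R -> {ffun opponent i -> bool} -> R.

Implicit Type h : reward.

Definition measurable_reward h :=
  forall (i : 'I_N) (a : {ffun opponent i -> bool}),
    measurable_fun ([set: borel_rV R n] `*` `[(0 : R), +oo[%classic)
      (fun xt : borel_rV R n * R => h i xt.1 xt.2 a).

Definition multi_affine h (i : 'I_N) (x : 'rV[R]_n) (t : R)
    (q : opponent i -> R) : R :=
  \sum_(a : {ffun opponent i -> bool})
    h i x t a *
    \prod_(j : opponent i) (q j ^+ a j * (1 - q j) ^+ (1 - a j)%N).

(* The opponents' status with b for player j and a for the others. *)
Definition with_status (i j : 'I_N) (b : bool)
    (a : {ffun opponent2 i j -> bool}) : {ffun opponent i -> bool} :=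
  [ffun k => if insub (val k) is Some k' then a k' else b].

Definition influence h (i j : 'I_N) : \bar R :=
  ereal_sup [set y | exists (x : 'rV[R]_n) (t : R) (a : {ffun opponent2 i j -> bool}),
    0 <= t /\
    y = (`| h i x t (with_status true a) - h i x t (with_status false a) |)%:E].

Context {dis : measure_display} {Omega : measurableType dis}.
Variables (P : probability Omega R) (F : R -> set (set Omega)).
Variable X : R -> Omega -> 'rV[R]_n.

Definition integrable_reward h :=
  forall i : 'I_N,
    (ereal_sup [set y | exists tau : 'I_N -> Omega -> R,
       (forall j, stopping_time F (tau j)) /\
       y = 'E_P[fun w => (`| h i (X (tau i w) w) (tau i w)
                  [ffun j : opponent i => tau (val j) w <= tau i w] |)%R] ]
     < +oo)%E.

Definition randomized_payoff h (i : 'I_N)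
    (p : 'I_N -> randomized_stopping F) : R :=
  fine 'E_P[fun w => path_integral (p i) w
    (fun t => multi_affine h (X t w) t (fun j : opponent i => p (val j) t w))].

Definition potential_candidate h (z p : 'I_N -> randomized_stopping F) : R :=
  \int[lebesgue_measure]_(r in `[0, 1])
    \sum_(i < N)
      fine 'E_P[fun w => path_integralB (p i) (z i) w
        (fun t => multi_affine h (X t w) t (fun j : opponent i =>
           z (val j) t w + r * (p (val j) t w - z (val j) t w)))].

End game.

Arguments reward : clear implicits.

(* Main.v *)
(* Write V_k(m, q) for the expected integral of g_k(X_t, t, q_t) against dm.
   As g_i does not depend on the i-th coordinate, the deviation of player i from
   p_i to s changes J_i by V_i(s, p) - V_i(p_i, p), and changes the integrand of
   Phi_z at r, where q^r = z + r (p - z) and q'^r is the same point after the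
   deviation, by
     V_i(s, q^r) - V_i(p_i, q^r)
       + sum_(k <> i) [V_k(p_k, q'^r) - V_k(z_k, q'^r)
                       - V_k(p_k, q^r) + V_k(z_k, q^r)].
   Since g_k is Lipschitz in q_j with constant L_kj and every dm has mass 1, the
   two changes differ by at most 2 sum_(j <> i) (L_ij + L_ji), for every r.

   The integrals are finite and measurable because dm(w) is the law of the
   quantile T(w, u) = inf {t | u <= m_t(w)} for u uniform in ]0, 1[: thus
   V_k(m, q) is an integral over Omega x ]0, 1[, and each T(., u) is a stopping
   time, to which the standing integrability assumption applies. *)
From HB Require Import structures.
Require Import Defs.

From mathcomp Require Import ring lra measurable_realfun.

Set Implicit Arguments.
Unset Strict Implicit.
Unset Printing Implicit Defensive.

Import Order.TTheory GRing.Theory Num.Theory.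
Import numFieldNormedType.Exports.

Local Open Scope classical_set_scope.
Local Open Scope ring_scope.

(** * Lipschitz bound for the multi-affine extension *)

Section multi_affine_lipschitz.
Context {R : realType} {N n : nat}.
Implicit Types (h : reward R N n) (i : 'I_N).

Definition flip_status i (j : opponent i) (a : {ffun opponent i -> bool}) :
    {ffun opponent i -> bool} :=
  [ffun k => if k == j then ~~ a k else a k].

Lemma flip_statusK i (j : opponent i) : involutive (flip_status j).
Proof.
by move=> a; apply/ffunP => k; rewrite !ffunE; case: eqVneq; rewrite ?negbK.
Qed.

Definition status_weight i (q : opponent i -> R) (j : opponent i) (b : bool) : R :=
  q j ^+ b * (1 - q j) ^+ (1 - b)%N.

Lemma status_weight1 i (q : opponent i -> R) j : status_weight q j true = q j.
Proof. by rewrite /status_weight /= subnn expr0 mulr1. Qed.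

Lemma status_weight0 i (q : opponent i -> R) j : status_weight q j false = 1 - q j.
Proof. by rewrite /status_weight /= expr0 mul1r. Qed.

Lemma status_weight_ge0 i (q : opponent i -> R) j b :
  0 <= q j <= 1 -> 0 <= status_weight q j b.
Proof.
by move=> /andP[q0 q1]; rewrite mulr_ge0// exprn_ge0// subr_ge0.
Qed.

(* Summing over the status of j first makes the affine dependence on q_j
   explicit. *)
Lemma sum_status_split i (j : opponent i) (q : opponent i -> R)
    (f : {ffun opponent i -> bool} -> R) :
  \sum_a f a * \prod_k status_weight q k (a k) =
  \sum_(a : {ffun opponent i -> bool} | a j)
     (q j * f a + (1 - q j) * f (flip_status j a)) *
     \prod_(k | k != j) status_weight q k (a k).
Proof.
rewrite (bigID (fun a : {ffun opponent i -> bool} => a j))/=.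
(* Flipping [j] maps the profiles with [a j] true bijectively onto those with [a j] false, so both
   halves become sums over the former. *)
rewrite [X in _ + X](reindex_inj (inv_inj (@flip_statusK i j)))/=.
rewrite [X in _ + X](eq_bigl (fun a : {ffun opponent i -> bool} => a j)); last first.
  by move=> a; rewrite ffunE eqxx negbK.
rewrite -big_split/=; apply: eq_bigr => a aj.
rewrite [X in f a * X](bigD1 j)//= [X in _ + _ * X](bigD1 j)//=.
rewrite [X in _ + _ * (_ * X)](eq_bigr (fun k => status_weight q k (a k))); last first.
  by move=> k kj; rewrite ffunE (negbTE kj).
rewrite ffunE eqxx aj status_weight1 status_weight0; ring.
Qed.

Lemma sum_status_weight i (q : opponent i -> R) :
  \sum_(a : {ffun opponent i -> bool}) \prod_k status_weight q k (a k) = 1.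
Proof.
rewrite -(bigA_distr_bigA (status_weight q)) big1// => j _.
by rewrite big_bool/= status_weight1 status_weight0; ring.
Qed.

(** Split the total mass of the product Bernoulli weights according to the status of [j]: for [f]
    constant 1 the bracket is [q j + (1 - q j) = 1]. *)
Lemma sum_status_weight_slice i (j : opponent i) (q : opponent i -> R) :
  \sum_(a : {ffun opponent i -> bool} | a j)
     \prod_(k | k != j) status_weight q k (a k) = 1.
Proof.
transitivity (\sum_(a : {ffun opponent i -> bool})
    (fun=> 1) a * \prod_k status_weight q k (a k)).
  by rewrite (sum_status_split j); apply: eq_bigr => a _; ring.
under eq_bigr do rewrite mul1r.
exact: sum_status_weight.
Qed.

Lemma flip_status_influence h i (j : opponent i) x t
    (a : {ffun opponent i -> bool}) :
  0 <= t -> influence h i (val j) \is a fin_num -> a j ->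
  `|h i x t a - h i x t (flip_status j a)| <= fine (influence h i (val j)).
Proof.
move=> t0 fj aj.
(* [a'] restricts [a] to the players other than [i] and [j]; as these are opponents of [i], the
   default [true] is never reached. *)
pose a' : {ffun opponent2 i (val j) -> bool} :=
  [ffun k => if insub (val k) is Some k' then a k' else true].
have aE b : with_status b a' = [ffun k => if k == j then b else a k].
  apply/ffunP => k; rewrite !ffunE; case: insubP => [k' /andP[_ kj] k'E|].
    rewrite ffunE k'E valK; case: (k =P j) kj => // ->.
    by rewrite eqxx.
  rewrite (valP k)/= negbK => /eqP/val_inj ->.
  by rewrite eqxx.
have -> : a = with_status true a'.
  by rewrite aE; apply/ffunP => k; rewrite ffunE; case: eqP => // ->.
have -> : flip_status j (with_status true a') = with_status false a'.
  by apply/ffunP => k; rewrite !aE !ffunE; case: eqP.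
rewrite -lee_fin fineK//; apply: ereal_sup_ubound.
by exists x, t, a'.
Qed.

(** With the other coordinates frozen, the extension is affine in [q j]; its slope averages the
    differences under a flip of [j], with nonnegative weights of sum 1. *)
Lemma multi_affine_lipschitz1 h i (j : opponent i) x t (q q' : opponent i -> R) :
  0 <= t -> influence h i (val j) \is a fin_num ->
  (forall k, 0 <= q k <= 1) -> (forall k, k != j -> q' k = q k) ->
  `|multi_affine h x t q - multi_affine h x t q'| <=
    fine (influence h i (val j)) * `|q j - q' j|.
Proof.
move=> t0 fj q01 qq'; rewrite /multi_affine.
have -> := sum_status_split j q (h i x t).
have -> := sum_status_split j q' (h i x t).
have W (a : {ffun opponent i -> bool}) :
    \prod_(k | k != j) status_weight q' k (a k) =
    \prod_(k | k != j) status_weight q k (a k).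
  by apply: eq_bigr => k kj; rewrite /status_weight qq'.
under [X in _ - X]eq_bigr do rewrite W.
rewrite -sumrB (le_trans (ler_norm_sum _ _ _))//.
rewrite -[leRHS]mulr1 -[X in _ <= _ * X](sum_status_weight_slice j q) mulr_sumr.
apply: ler_sum => a aj.
have w0 : 0 <= \prod_(k | k != j) status_weight q k (a k).
  by apply: prodr_ge0 => k _; exact: status_weight_ge0.
rewrite -mulrBl normrM (ger0_norm w0) ler_wpM2r//.
have -> : q j * h i x t a + (1 - q j) * h i x t (flip_status j a) -
    (q' j * h i x t a + (1 - q' j) * h i x t (flip_status j a)) =
    (h i x t a - h i x t (flip_status j a)) * (q j - q' j) by ring.
by rewrite normrM ler_wpM2r// flip_status_influence.
Qed.

(** The coordinates of [q] are replaced one at a time by those of [q'], and the one-coordinate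
    bounds are added; [hybrid s] is the point reached once those in [s] are replaced. *)
Lemma multi_affine_lipschitz h i x t (q q' : opponent i -> R) :
  0 <= t -> (forall j : opponent i, influence h i (val j) \is a fin_num) ->
  (forall k, 0 <= q k <= 1) -> (forall k, 0 <= q' k <= 1) ->
  `|multi_affine h x t q - multi_affine h x t q'| <=
    \sum_(j : opponent i) fine (influence h i (val j)) * `|q j - q' j|.
Proof.
move=> t0 fj q01 q'01.
pose hybrid (s : seq (opponent i)) k := if k \in s then q' k else q k.
have hybrid01 s k : 0 <= hybrid s k <= 1 by rewrite /hybrid; case: ifP.
have hybridP (s : seq (opponent i)) : uniq s ->
    `|multi_affine h x t q - multi_affine h x t (hybrid s)| <=
    \sum_(j <- s) fine (influence h i (val j)) * `|q j - q' j|.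
  elim: s => [_|j s IHs /= /andP[js us]]; first by rewrite big_nil subrr normr0.
  rewrite big_cons [leRHS]addrC.
  apply: le_trans (ler_distD (multi_affine h x t (hybrid s)) _ _) _.
  apply: lerD; first exact: IHs.
  have -> : q j = hybrid s j by rewrite /hybrid (negbTE js).
  have -> : q' j = hybrid (j :: s) j by rewrite /hybrid mem_head.
  apply: multi_affine_lipschitz1 => // k kj.
  by rewrite /hybrid in_cons (negbTE kj).
have -> : q' = hybrid (index_enum (opponent i)).
  by apply/funext => k; rewrite /hybrid mem_index_enum.
apply: le_trans (hybridP _ (index_enum_uniq _)) _.
by apply: ler_sum => j _; rewrite /hybrid mem_index_enum.
Qed.

(** Only the profile in which no opponent has stopped keeps a nonzero weight. This value is the
    reference point for integrability at a general [q]. *)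
Lemma multi_affine0 h i x t :
  @multi_affine R N n h i x t (fun=> 0) = h i x t [ffun=> false].
Proof.
rewrite /multi_affine (bigD1 [ffun=> false])//= [X in _ * X]big1 => [|j _].
  rewrite mulr1 big1 ?addr0// => a a0.
  have /existsP[j aj] : [exists j, a j].
    apply: contraNT a0; rewrite negb_exists => /forallP aF.
    by apply/eqP/ffunP => j; rewrite ffunE; apply/negbTE.
  by rewrite (bigD1 j)//= aj expr1 !mul0r mulr0.
by rewrite ffunE /= expr0 mul1r subr0 expr1n.
Qed.

End multi_affine_lipschitz.

(** * Joint measurability of right-continuous processes *)

Section joint_measurability.
Context {R : realType} {dis : measure_display} {Omega : measurableType dis}.

(** For [t >= 0], the first multiple of [1/(k+1)] strictly after [t]; strictness makes it converge
    along [t^'+], which excludes [t] itself. *)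
Definition right_grid (k : nat) (t : R) : R := (Num.trunc (k.+1%:R * t)).+1%:R / k.+1%:R.

Lemma right_grid_itv k t : 0 <= t -> t < right_grid k t <= t + k.+1%:R^-1.
Proof.
move=> t0; have kt0 : 0 <= k.+1%:R * t by rewrite mulr_ge0.
have /andP[le_kt lt_kt] := truncn_itv kt0.
rewrite /right_grid ltr_pdivlMr// mulrC lt_kt/= ler_pdivrMr// mulrDl mulVf//.
by rewrite -natr1 lerD2r [t * _]mulrC.
Qed.

Lemma cvg_right_grid t : 0 <= t -> right_grid k t @[k --> \oo] --> t^'+.
Proof.
move=> t0 A [e /= e0 eA].
suff: \forall k \near \oo, A (right_grid k t) by [].
near=> k; have ke : k.+1%:R^-1 < e :> R.
  by near: k; exact: near_infty_natSinv_lt (PosNum e0).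
have /andP[tk kt] := right_grid_itv k t0.
apply: eA => //=; rewrite ltr0_norm ?subr_lt0// opprB.
by apply: le_lt_trans ke; rewrite lerBlDl.
Unshelve. all: by end_near. Qed.

(** The grid time takes countably many values, all nonnegative, so a preimage is a countable union
    of measurable rectangles. *)
Lemma measurable_right_grid_process d (V : measurableType d) (Y : R -> Omega -> V) k :
  (forall t, 0 <= t -> measurable_fun setT (Y t)) ->
  measurable_fun setT (fun wt : Omega * R => Y (right_grid k wt.2) wt.1).
Proof.
move=> mY _ B mB; rewrite setTI.
pose G (m : nat) : R := m.+1%:R / k.+1%:R.
have -> : (fun wt : Omega * R => Y (right_grid k wt.2) wt.1) @^-1` B =
  \bigcup_m ((Y (G m) @^-1` B) `*` [set t : R | Num.trunc (k.+1%:R * t) = m]).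
  apply/seteqP; split => [[w t] /= Bwt|[w t] [m _ [/= Bw mE]]]; last first.
    by rewrite /right_grid mE.
  by exists (Num.trunc (k.+1%:R * t)).
apply: bigcup_measurable => m _; apply: measurableX.
  rewrite -[X in measurable X]setTI; apply: mY => //.
  by rewrite divr_ge0.
pose f (t : R) : R := (Num.trunc (k.+1%:R * t))%:R.
have mf : measurable_fun setT f.
  apply: nondecreasing_measurable => // s t st.
  by rewrite ler_nat le_truncn// ler_wpM2l.
have -> : [set t : R | Num.trunc (k.+1%:R * t) = m] = f @^-1` [set m%:R].
  by apply/seteqP; split=> t /= => [<-//|/eqP]; rewrite eqr_nat => /eqP.
by rewrite -[X in measurable X]setTI; exact: mf.
Qed.

End joint_measurability.

(** The limit lies in an open [U] iff, for some [m], the sequence eventually stays in the interior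
    of the set of points whose ball of radius [1/(m+1)] lies in [U]. This is a countable combination
    of preimages of open sets. *)
Lemma measurable_lim_open {R : realType} {n : nat} d (T : measurableType d)
    (f_ : nat -> T -> 'rV[R]_n) (f : T -> 'rV[R]_n) :
  (forall k, measurable_fun setT (f_ k : T -> borel_rV R n)) ->
  (forall x, f_ k x @[k --> \oo] --> f x) ->
  measurable_fun setT (f : T -> borel_rV R n).
Proof.
move=> mf_ f_f.
apply: (@measurability _ _ T (borel_rV R n) setT f (@open 'rV[R]_n)) => //.
move=> _ [U oU <-].
rewrite setTI.
pose U_ (m : nat) := [set x : 'rV[R]_n | ball x m.+1%:R^-1 `<=` U]^°.
have -> : f @^-1` U = \bigcup_m \bigcup_K \bigcap_(k in [set k | (K <= k)%N])
    (f_ k @^-1` U_ m).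
  apply/seteqP; split => [x /= Ufx|x [m _ [K _ fU]]].
    move: oU; rewrite openE => /(_ _ Ufx) /nbhs_ballP[e /= e0 eU].
    have [m me] : exists m : nat, m.+1%:R^-1 < e / 2.
      have e20 : 0 < e / 2 by rewrite divr_gt0.
      have [m _ /(_ m (leqnn m)) ?] := near_infty_natSinv_lt (PosNum e20).
      by exists m.
    exists m => //.
    have nU : nbhs (f x) (U_ m).
      apply: open_nbhs_nbhs; split; first exact: open_interior.
      apply/nbhs_ballP; exists (e / 2) => /=; first by rewrite divr_gt0.
      move=> y fxy z yz; apply: eU; apply: ball_split fxy _.
      by apply: le_ball yz; exact: ltW.
    by have [K _ KU] := f_f x _ nU; exists K.
  have [k Kk] : exists2 k, (K <= k)%N & ball (f_ k x) m.+1%:R^-1 (f x).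
    have m0 : 0 < m.+1%:R^-1 :> R by rewrite invr_gt0.
    have [K' _ K'b] := f_f x _ (nbhsx_ballx (f x) m.+1%:R^-1 m0).
    exists (maxn K K'); first exact: leq_maxl.
    apply: ball_sym; apply: K'b => /=; exact: leq_maxr.
  by have /interior_subset := fU _ Kk; apply.
apply: bigcup_measurable => m _; apply: bigcup_measurable => K _.
apply: bigcap_measurable => [|k _]; first by exists K => /=.
rewrite -[X in measurable X]setTI; apply: mf_ => //.
apply: sub_sigma_algebra; exact: open_interior.
Qed.

Section right_continuous_processes.
Context {R : realType} {dis : measure_display} {Omega : measurableType dis}.

(** Processes are constrained at nonnegative times only; clamping by [Num.max 0] lets the time
    variable range over the whole line. *)
Lemma measurable_clamp_time :
  measurable_fun setT (fun wt : Omega * R => (wt.1, Num.max 0 wt.2)).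
Proof.
apply: measurable_fun_pair; first exact: measurable_fst.
by apply: measurable_maxr => //; exact: measurable_snd.
Qed.

Lemma measurable_right_continuous_process (Y : R -> Omega -> R) :
  (forall t, 0 <= t -> measurable_fun setT (Y t)) ->
  (forall w t, 0 <= t -> Y x w @[x --> t^'+] --> Y t w) ->
  measurable_fun setT (fun wt : Omega * R => Y (Num.max 0 wt.2) wt.1).
Proof.
move=> mY rcY.
apply: (@measurable_fun_cvg _ _ _ _
  (fun k (wt : Omega * R) => Y (right_grid k (Num.max 0 wt.2)) wt.1)).
  move=> k.
  exact: (measurableT_comp (measurable_right_grid_process k mY)
    measurable_clamp_time).
move=> [w t] _ /=.
have t0 : 0 <= Num.max 0 t by rewrite le_max lexx.
exact: cvg_comp (cvg_right_grid t0) (rcY w _ t0).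
Qed.

Lemma measurable_right_continuous_vector_process n (Y : R -> Omega -> 'rV[R]_n) :
  (forall t, 0 <= t -> measurable_fun setT (Y t : Omega -> borel_rV R n)) ->
  (forall w t, 0 <= t -> Y x w @[x --> t^'+] --> Y t w) ->
  measurable_fun setT
    ((fun wt => Y (Num.max 0 wt.2) wt.1) : Omega * R -> borel_rV R n).
Proof.
move=> mY rcY.
apply: (@measurable_lim_open _ _ _ _
  (fun k (wt : Omega * R) => Y (right_grid k (Num.max 0 wt.2)) wt.1)).
  move=> k.
  exact: (measurableT_comp (measurable_right_grid_process k mY)
    measurable_clamp_time).
move=> [w t]/=.
have t0 : 0 <= Num.max 0 t by rewrite le_max lexx.
exact: cvg_comp (cvg_right_grid t0) (rcY w _ t0).
Qed.

End right_continuous_processes.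

(** * The uniform law on ]0, 1[ *)

Section uniform_law.
Context (R : realType).

Definition lebesgue01 : set (measurableTypeR R) -> \bar R :=
  mrestr (@lebesgue_measure R) (measurable_itv `](0 : R), 1[).

HB.instance Definition _ := Measure.on lebesgue01.

Let lebesgue01_setT : lebesgue01 setT = 1%E.
Proof.
by rewrite /lebesgue01 /mrestr setTI lebesgue_measure_itv/= lte_fin ltr01 sube0.
Qed.

HB.instance Definition _ :=
  @Measure_isProbability.Build _ _ _ lebesgue01 lebesgue01_setT.

Definition unif01 : probability (measurableTypeR R) R := lebesgue01.

End uniform_law.

(** * Quantiles of a randomized stopping time *)

Section quantile.
Context {R : realType} {dis : measure_display} {Omega : measurableType dis}.
Context {F : R -> set (set Omega)} (p : randomized_stopping F).

Lemma rs_path_itv w t : 0 <= rs_path p w t <= 1.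
Proof.
by rewrite /rs_path; case: ltP => t0; [rewrite lexx ler01|exact: rs_itv].
Qed.

(* Levels outside ]0, 1[ get the value 0, so that every level gives a stopping
   time. *)
Definition quantile (w : Omega) (u : R) : R :=
  if 0 < u < 1 then inf [set t | u <= rs_path p w t] else 0.

(** The set of times where the path is at least [u] is nonempty because the path tends to 1 > [u],
    bounded below by 0 because the path vanishes before 0 < [u], and contains its infimum by right
    continuity. *)
Lemma quantile_le w u t : 0 < u < 1 -> (quantile w u <= t) = (u <= rs_path p w t).
Proof.
move=> u01; rewrite /quantile u01; case/andP: u01 => u0 u1.
set E := [set t | _].
have E0 : lbound E 0.
  move=> s; rewrite /E /= /rs_path; case: ltP => // _.
  by rewrite leNgt u0.
have Enonempty : E !=set0.
  near (+oo : set_system R) => s; exists s.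
  have s0 : 0 <= s by near: s; exact: nbhs_pinfty_ge.
  rewrite /E /= /rs_path ltNge s0/=; apply/ltW; near: s.
  by apply: (cvgr_gt _ (rs_infty p w)).
have Einf : E (inf E).
  rewrite /E /= leNgt; apply/negP => lt_u.
  have rc := cumulative_is_right_continuous (rs_path p w) (inf E).
  near (inf E)^'+ => s.
  have infs : inf E < s by near: s; exact: nbhs_right_gt.
  have [e Ee es] : exists2 e, E e & e < s.
    have s0 : 0 < s - inf E by rewrite subr_gt0.
    have hE : has_inf E by split => //; exists 0.
    have [e Ee] := inf_adherent s0 hE.
    by rewrite subrKC; exists e.
  have : rs_path p w s < u by near: s; exact: (cvgr_lt _ rc).
  rewrite ltNge (le_trans Ee)//.
  by apply: (cumulative_is_nondecreasing (rs_path p w)); exact: ltW.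
apply/idP/idP => [|ut]; last by apply: ge_inf => //; exists 0.
by move=> /(cumulative_is_nondecreasing (rs_path p w)); exact: le_trans.
Unshelve. all: by end_near. Qed.

Lemma quantile_ge0 w u : 0 <= quantile w u.
Proof.
have [u01|u01] := boolP (0 < u < 1); last by rewrite /quantile (negbTE u01).
rewrite leNgt; apply/negP => q0.
have := quantile_le w (quantile w u) u01.
by rewrite lexx => /esym; rewrite /rs_path q0 leNgt; case/andP: u01 => ->.
Qed.

(** For [u] in ]0, 1[ the event is that [p t] is at least [u], which adaptedness puts in [F t]; for
    other levels it is the whole space. *)
Lemma stopping_time_quantile u : filtration F -> stopping_time F (quantile ^~ u).
Proof.
move=> [sF _ _]; split => [w|t t0]; first exact: quantile_ge0.
have [u01|u01] := boolP (0 < u < 1); last first.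
  rewrite /quantile (negbTE u01) (_ : [set _ | _] = setT); last first.
    by apply/seteqP; split.
  rewrite -setC0.
  have [F0 + _] := sF _ t0.
  by move=> /(_ _ F0); rewrite setTD.
rewrite (_ : [set _ | _] = p t @^-1` `[u, +oo[).
  by apply: rs_adapted.
apply/seteqP; split => w /=; rewrite quantile_le//= /rs_path ltNge t0/= in_itv/=.
  by move=> ->.
by rewrite andbT.
Qed.

Lemma measurable_rs t : filtration F -> 0 <= t -> measurable_fun setT (p t).
Proof.
move=> [_ Fm _] t0 _ B mB; rewrite setTI; apply: (Fm _ t0).
exact: rs_adapted.
Qed.

Lemma measurable_quantile : filtration F ->
  measurable_fun setT (fun wu : Omega * R => quantile wu.1 wu.2).
Proof.
move=> filF; apply: (measurability _ (RGenOInfty.measurableE R)) => //.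
move=> _ [_ [t ->] <-]; rewrite setTI.
have -> : (fun wu : Omega * R => quantile wu.1 wu.2) @^-1` `]t, +oo[ =
    ~` [set wu | quantile wu.1 wu.2 <= t].
  by apply/seteqP; split => wu/=; rewrite in_itv/= andbT ltNge => /negP.
apply: measurableC.
have [t0|t0] := ltP t 0.
  rewrite (_ : [set _ | _] = set0)//; apply/seteqP; split => // wu /=.
  by apply/negP; rewrite -ltNge (lt_le_trans t0)// quantile_ge0.
rewrite (_ : [set _ | _] = (setT `*` ~` `]0, 1[) `|`
    ((setT `*` `]0, 1[) `&` [set wu : Omega * R | wu.2 <= p t wu.1])); last first.
  apply/seteqP; split=> [[w u]|[w u]]/=; rewrite in_itv/=.
    have [u01|u01] := boolP (0 < u < 1); last by left.
    by rewrite quantile_le// /rs_path ltNge t0/= => up; right.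
  case=> [[_ u01]|[[_ u01]]]; last by rewrite quantile_le// /rs_path ltNge t0.
  by rewrite /quantile ifF//; apply/negP.
apply: measurableU; first by apply: measurableX => //; exact: measurableC.
apply: measurableI; first exact: measurableX.
rewrite -[X in measurable X]setTI; apply: measurable_fun_le => //.
apply: measurableT_comp; first exact: measurable_rs.
exact: measurable_fst.
Qed.

(** Inverse transform sampling: the law of the quantile and the Stieltjes measure agree on the
    intervals []a, b]], which determine the latter. *)
Lemma lebesgue_stieltjes_quantile w (T : {RV (@unif01 R) >-> measurableTypeR R}) :
  T =1 quantile w :> (R -> R) ->
  forall A : set (measurableTypeR R), measurable A ->
  lebesgue_stieltjes_measure (rs_path p w) A = distribution (@unif01 R) T A.
Proof.
move=> Tq; apply: lebesgue_stieltjes_measure_unique => _ [[a b]/= _ <-].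
rewrite /lebesgue_stieltjes_measure /measure_extension/=.
rewrite measurable_mu_extE/=; last exact: is_ocitv.
have [ab|ba] := leP a b; last first.
  by rewrite set_itv_ge ?wlength0 ?measure0// bnd_simp -leNgt ltW.
rewrite wlength_itv_bnd//= /distribution /pushforward /= /lebesgue01 /mrestr.
have -> : T @^-1` `]a, b] `&` `]0, 1[ = `]rs_path p w a, rs_path p w b] `&` `]0, 1[.
  apply/seteqP; split => u [] /=; rewrite !in_itv/= Tq => uab u01; split => //.
    by move: uab; rewrite quantile_le// !ltNge quantile_le.
  by rewrite quantile_le// ltNge quantile_le// -ltNge.
set al := rs_path p w a; set be := rs_path p w b.
have albe : al <= be by exact: cumulative_is_nondecreasing.
have al0 : 0 <= al by have /andP[] := rs_path_itv w a.
have be1 : be <= 1 by have /andP[] := rs_path_itv w b.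
(* Intersecting with ]0, 1[ removes the right endpoint exactly when [be = 1]; the length is
   [be - al] in both cases. *)
have -> : `]al, be] `&` `]0, 1[ =
    [set` Interval (BRight al) (BSide (be == 1) be)] :> set R.
  apply/seteqP; split => u /=; rewrite !in_itv/=.
    case=> /andP[au ub] /andP[u0 u1]; rewrite au/=.
    by case: eqVneq => [->|_] /=.
  case: eqVneq => [->|be_neq1] /= /andP[au ub].
    by rewrite au ub (ltW ub) (le_lt_trans al0 au).
  by rewrite au ub (le_lt_trans al0 au)/= (le_lt_trans ub)// lt_neqAle be_neq1.
rewrite lebesgue_measure_itv/= lte_fin EFinB.
by case: ltgtP albe => // -> _; rewrite subee.
Qed.

End quantile.

(** * Path integrals as integrals over Omega x ]0, 1[ *)

Section path_integral_quantile.
Context {R : realType} {dis : measure_display} {Omega : measurableType dis}.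
Context (P : probability Omega R) {F : R -> set (set Omega)}.
Context (p : randomized_stopping F).
Hypothesis filF : filtration F.

Lemma path_integral_quantile w (f : R -> R) :
  measurable_fun [set: R] (fun t : R => f (Num.max 0 t)) ->
  path_integral p w f = fine (\int[@unif01 R]_u (f (quantile p w u))%:E)%E.
Proof.
move=> mf; rewrite /path_integral /Rintegral; congr fine.
have mq : measurable_fun setT (quantile p w : measurableTypeR R -> measurableTypeR R).
  exact: (measurableT_comp (measurable_quantile p filF) (measurable_pair1 w)).
pose T : {RV (@unif01 R) >-> measurableTypeR R} :=
  HB.pack (quantile p w : measurableTypeR R -> measurableTypeR R)
    (isMeasurableFun.Build _ _ _ _ _ mq).
rewrite (@eq_measure_integral _ _ _ _ (distribution (@unif01 R) T)); last first.
  by move=> A mA _; exact: lebesgue_stieltjes_quantile.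
pose g t := (f (Num.max 0 t))%:E.
have mg : measurable_fun setT g by exact/measurable_EFinP.
transitivity (\int[distribution (@unif01 R) T]_(t in `[0%R, +oo[) g t)%E.
  apply: eq_integral => t; rewrite inE/= in_itv/= andbT => t0.
  by rewrite /g max_r.
have Tpos : T @^-1` `[0, +oo[ = setT.
  by apply/seteqP; split => // u _ /=; rewrite in_itv/= andbT quantile_ge0.
have gT u : g (T u) = (f (quantile p w u))%:E.
  by rewrite /g /= max_r// quantile_ge0.
(* The change of variables is made on the positive and negative parts separately, as [f] may fail to
   be integrable at this [w]. *)
rewrite integralE [RHS]integralE /distribution.
rewrite !ge0_integral_pushforward//; last 2 first.
- exact/measurable_funTS/measurable_funeneg.
- exact/measurable_funTS/measurable_funepos.
rewrite Tpos; congr (_ - _)%E; apply: eq_integral => u _ /=.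
  by rewrite !funeposE gT.
by rewrite !funenegE gT.
Qed.

Variable f : Omega -> R -> R.
Hypothesis mf : measurable_fun setT (fun wt : Omega * R => f wt.1 (Num.max 0 wt.2)).

Let mu := (P \x @unif01 R)%E.
Let K (wu : Omega * measurableTypeR R) := f wu.1 (quantile p wu.1 wu.2).

Lemma measurable_quantile_comp : measurable_fun setT K.
Proof.
have -> : K = (fun wt : Omega * R => f wt.1 (Num.max 0 wt.2)) \o
    (fun wu : Omega * R => (wu.1, quantile p wu.1 wu.2)).
  by apply/funext => -[w u] /=; rewrite /K max_r// quantile_ge0.
apply: measurableT_comp => //; apply: measurable_fun_pair.
  exact: measurable_fst.
exact: measurable_quantile.
Qed.

Lemma path_integral_fubini w :
  path_integral p w (f w) = fine (fubini_F (@unif01 R) (EFin \o K) w).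
Proof.
rewrite path_integral_quantile//.
exact: (measurableT_comp mf (pair1_measurable w)).
Qed.

Hypothesis intK : mu.-integrable setT (EFin \o K).

Let intF : P.-integrable setT (fubini_F (@unif01 R) (EFin \o K)).
Proof. exact: integrable_fubini_F. Qed.

Lemma integrable_path_integral :
  P.-integrable setT (EFin \o (fun w => path_integral p w (f w))).
Proof.
apply: (le_integrable measurableT _ _ intF).
  under eq_fun do rewrite /= path_integral_fubini.
  apply/measurable_EFinP; apply: measurableT_comp => //.
  exact: measurable_int intF.
(* [fine] sends infinite values to 0, so the domination also holds where the inner integral is
   infinite. *)
move=> w _ /=; rewrite path_integral_fubini.
by case: fubini_F => [r| |]; rewrite /= ?lexx ?leey.
Qed.

Lemma expectation_path_integral :
  'E_P[fun w => path_integral p w (f w)]%E = (\int[mu]_wu (K wu)%:E)%E.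
Proof.
rewrite unlock -(integral12_prod_meas1 intK).
apply: ae_eq_integral => //.
- exact: measurable_int integrable_path_integral.
- exact: measurable_int intF.
(* The inner integral is finite almost everywhere, and there [fine] loses nothing. *)
have := integrable_ae measurableT intF; apply: filterS => w /(_ I) finF _.
by rewrite /= path_integral_fubini fineK.
Qed.


End path_integral_quantile.

(** * Auxiliary facts on stopping times, influences and expectations *)

Lemma stopping_timeD1 {R : realType} {dis : measure_display}
    {Omega : measurableType dis} (F : R -> set (set Omega)) (tau : Omega -> R) :
  filtration F -> stopping_time F tau -> stopping_time F (fun w => tau w + 1).
Proof.
move=> [sF _ homoF] [tau0 tauF]; split => [w|t t0]; first by rewrite addr_ge0.
have [t1|t1] := leP 1 t.
  rewrite (_ : [set _ | _] = [set w | tau w <= t - 1]); last first.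
    by apply/seteqP; split => w /=; rewrite lerBrDr.
  apply: (homoF (t - 1)); rewrite ?subr_ge0// ?lerBlDr ?lerDl//.
  by apply: tauF; rewrite subr_ge0.
rewrite (_ : [set _ | _] = set0); first by have [] := sF _ t0.
apply/seteqP; split => // w /=; apply/negP; rewrite -ltNge.
by rewrite (lt_le_trans t1)// lerDr.
Qed.

Lemma influence_ge0 {R : realType} {N n : nat} (h : reward R N n) i j :
  (0 <= influence h i j)%E.
Proof.
apply: (@le_trans _ _ (`|h i 0 0 (with_status true [ffun=> false]) -
   h i 0 0 (@with_status N i j false [ffun=> false])|%:E)); first by rewrite lee_fin.
by apply: ereal_sup_ubound; exists 0, 0, [ffun=> false].
Qed.

Lemma integrable_product_cst {R : realType} {d1 d2 : measure_display}
    {T1 : measurableType d1} {T2 : measurableType d2}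
    (P1 : probability T1 R) (P2 : probability T2 R) (c : R) :
  (P1 \x P2)%E.-integrable setT (EFin \o cst c).
Proof.
pose mu : probability _ R := (P1 \x P2)%E.
exact: (@finite_measure_integrable_cst _ _ R mu).
Qed.

Lemma product_probability_setT {R : realType} {d1 d2 : measure_display}
    {T1 : measurableType d1} {T2 : measurableType d2}
    (P1 : probability T1 R) (P2 : probability T2 R) :
  (P1 \x P2)%E setT = 1%E.
Proof.
pose mu : probability _ R := (P1 \x P2)%E.
exact: (@probability_setT _ _ _ mu).
Qed.

Lemma fine_expectationB {R : realType} {dis : measure_display}
    {Omega : measurableType dis} (P : probability Omega R) (f g : Omega -> R) :
  P.-integrable setT (EFin \o f) -> P.-integrable setT (EFin \o g) ->
  fine 'E_P[fun w => f w - g w] = fine 'E_P[f] - fine 'E_P[g].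
Proof.
move=> intf intg; rewrite unlock -fineB ?integrable_fin_num//.
by rewrite -integralB_EFin.
Qed.

(** * Measurability, integrability and Lipschitz dependence of payoffs *)

Section payoff_regularity.
Context {R : realType} {N n : nat}.
Context {dis : measure_display} {Omega : measurableType dis}.
Context (P : probability Omega R) {F : R -> set (set Omega)}.
Context (X : R -> Omega -> 'rV[R]_n) (h : reward R N n).
Arguments h : clear implicits.
Hypotheses (filF : filtration F) (contX : continuous_process X).
Hypotheses (genX : generated_by P F X) (mh : measurable_reward h).

Lemma measurable_generator t : 0 <= t ->
  measurable_fun setT (X t : Omega -> borel_rV R n).
Proof.
move=> t0 _ B mB; rewrite setTI.
have [_ Fm _] := filF; apply: (Fm _ t0).
rewrite genX// => s /= ts; apply: sub_sigma_algebra; left.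
by exists t, B; split => //; rewrite t0 ltW.
Qed.

Lemma right_continuous_generator w t : 0 <= t -> X x w @[x --> t^'+] --> X t w.
Proof.
move=> t0.
have /continuous_within_itvcyP[cX cX0] : {within `[0, +oo[, continuous (X ^~ w)}.
  exact: contX.
move: t0; rewrite le_eqVlt => /predU1P[<-//|t0].
by apply: cvg_within_filter; apply: cX; rewrite in_itv/= t0.
Qed.

Lemma measurable_reward_process i a :
  measurable_fun setT (fun wt : Omega * R =>
    h i (X (Num.max 0 wt.2) wt.1) (Num.max 0 wt.2) a).
Proof.
pose g (wt : Omega * R) : borel_rV R n * R :=
  (X (Num.max 0 wt.2) wt.1, Num.max 0 wt.2).
apply: (@measurable_comp _ _ _ _ _ _ ([set: borel_rV R n] `*` `[(0 : R), +oo[)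
  (fun xt : borel_rV R n * R => h i xt.1 xt.2 a) setT g).
- exact: measurableX.
- by move=> _ [wt _ <-]; split => //=; rewrite in_itv/= le_max lexx.
- exact: mh.
apply: measurable_fun_pair.
  apply: measurable_right_continuous_vector_process.
  - exact: measurable_generator.
  - exact: right_continuous_generator.
by apply: measurable_maxr => //; exact: measurable_snd.
Qed.

(** A class of opponent processes containing both the strategy profiles and the interpolated
    profiles that enter the potential. *)
Definition admissible (i : 'I_N) (q : opponent i -> R -> Omega -> R) :=
  (forall j, measurable_fun setT (fun wt : Omega * R => q j (Num.max 0 wt.2) wt.1)) /\
  (forall j t w, 0 <= t -> 0 <= q j t w <= 1).

Lemma measurable_multi_affine i (q : opponent i -> R -> Omega -> R) :
  admissible q ->
  measurable_fun setT (fun wt : Omega * R =>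
    multi_affine h (X (Num.max 0 wt.2) wt.1) (Num.max 0 wt.2)
      (fun j => q j (Num.max 0 wt.2) wt.1)).
Proof.
move=> [mq _]; apply: measurable_sum => a; apply: measurable_funM.
  exact: measurable_reward_process.
apply: measurable_prod => j _; apply: measurable_funM.
  exact: measurable_funX.
by apply: measurable_funX; apply: measurable_funB.
Qed.

Hypothesis intR : integrable_reward P F X h.
Hypothesis finL : forall i j : 'I_N, j != i -> influence h i j \is a fin_num.

Local Notation mu := (P \x @unif01 R)%E.

(** At a fixed level [u] the quantile is a stopping time, so the standing assumption bounds the
    integral over [Omega] by a constant independent of [u]; Tonelli concludes. *)
Lemma integrable_quiet_reward i (m : randomized_stopping F) :
  mu.-integrable setT (EFin \o (fun wu : Omega * measurableTypeR R =>
    h i (X (quantile m wu.1 wu.2) wu.1) (quantile m wu.1 wu.2) [ffun=> false])).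
Proof.
set K := fun wu : Omega * measurableTypeR R => _.
have mK : measurable_fun setT K.
  exact: (measurable_quantile_comp (f := fun w t => h i (X t w) t [ffun=> false])
    m filF (measurable_reward_process _)).
have mK' : measurable_fun setT (EFin \o K) by exact/measurable_EFinP.
apply/(integrable21ltyP _ _ mK').
have := intR i; set C := ereal_sup _ => Coo.
have KC u : (\int[P]_w `|(EFin \o K) (w, u)| <= C)%E.
  apply: ereal_sup_ubound.
  (* Every opponent stops one unit of time after player [i], so all statuses are [false] when [i]
     stops. *)
  pose tau (j : 'I_N) w := quantile m w u + (j != i)%:R.
  exists tau; split.
    move=> j; rewrite /tau; case: (j != i) => /=; last first.
      under eq_fun do rewrite addr0.
      exact: stopping_time_quantile.
    exact/stopping_timeD1/stopping_time_quantile.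
  rewrite unlock; apply: eq_integral => w _ /=; congr (`|h i _ _ _|%:E).
  - by rewrite /tau eqxx addr0.
  - by rewrite /tau eqxx addr0.
  - apply/ffunP => j; rewrite !ffunE /tau eqxx addr0 (valP j) gerDl.
    by rewrite ler10.
have Cge0 : (0 <= C)%E by apply: le_trans (KC 0); exact: integral_ge0.
apply: (@le_lt_trans _ _ (\int[@unif01 R]_u cst C u)%E).
  apply: ge0_le_integral => //.
  - by move=> u _; exact: integral_ge0.
  - apply: (measurable_fun_fubini_tonelli_G (abse \o (EFin \o K))) => //=.
    exact: measurableT_comp.
rewrite integral_cst// [X in (_ * X)%E](_ : _ = 1%E) ?mule1//.
exact: probability_setT.
Qed.

(** Moving each coordinate from 0 to a value in [0, 1] changes the reward by at most the sum [L] of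
    the influences, so [|K0| + L] dominates. *)
Lemma integrable_payoff i (m : randomized_stopping F)
    (q : opponent i -> R -> Omega -> R) :
  admissible q ->
  mu.-integrable setT (EFin \o (fun wu : Omega * measurableTypeR R =>
    multi_affine h (X (quantile m wu.1 wu.2) wu.1) (quantile m wu.1 wu.2)
      (fun j => q j (quantile m wu.1 wu.2) wu.1))).
Proof.
move=> aq; have [_ q01] := aq.
set K := fun wu : Omega * measurableTypeR R => _.
pose K0 (wu : Omega * measurableTypeR R) :=
  h i (X (quantile m wu.1 wu.2) wu.1) (quantile m wu.1 wu.2) [ffun=> false].
pose L := \sum_(j : opponent i) fine (influence h i (val j)).
have L0 (j : opponent i) : 0 <= fine (influence h i (val j)).
  by rewrite fine_ge0// influence_ge0.
have intL : mu.-integrable setT (EFin \o cst L : _ * measurableTypeR R -> _).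
  exact: integrable_product_cst.
have intK0 := integrable_norm (integrable_quiet_reward i m).
apply: (le_integrable measurableT _ _ (integrableD measurableT intK0 intL)).
  apply/measurable_EFinP.
  exact: (measurable_quantile_comp
    (f := fun w t => multi_affine h (X t w) t (fun j => q j t w))
    m filF (measurable_multi_affine aq)).
move=> [w u] _; rewrite /= lee_fin [leRHS]ger0_norm ?addr_ge0 ?sumr_ge0//.
rewrite -(multi_affine0 h) /K /= addrC -lerBlDr.
apply: le_trans (lerB_dist _ _) _.
have q0 := quantile_ge0 m w u.
apply: le_trans (multi_affine_lipschitz _ q0 _ _ _) _.
- by move=> j; rewrite finL// (valP j).
- by move=> k; exact: q01.
- by move=> k; rewrite lexx ler01.
apply: ler_sum => j _; rewrite ler_piMr// subr0.
by have /andP[qj0 qj1] := q01 j _ w q0; rewrite ger0_norm.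
Qed.

(** This is V_i(m, q): the integrator [m] is independent of the profile [q], so that deviations and
    interpolations can change one without the other. *)
Definition payoff (i : 'I_N) (m : randomized_stopping F)
    (q : opponent i -> R -> Omega -> R) : R :=
  fine 'E_P[fun w => path_integral m w
    (fun t => multi_affine h (X t w) t (fun j => q j t w))].

Lemma payoffB i (m m' : randomized_stopping F) (q : opponent i -> R -> Omega -> R) :
  admissible q ->
  fine 'E_P[fun w => path_integralB m m' w
    (fun t => multi_affine h (X t w) t (fun j => q j t w))] =
  payoff m q - payoff m' q.
Proof.
move=> aq.
have mg := measurable_multi_affine aq.
pose f w t := multi_affine h (X t w) t (fun j => q j t w).
have I1 := integrable_path_integral (f := f) filF mg (integrable_payoff m aq).
have I2 := integrable_path_integral (f := f) filF mg (integrable_payoff m' aq).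
exact: fine_expectationB I1 I2.
Qed.

Lemma payoffE i (m : randomized_stopping F) (q : opponent i -> R -> Omega -> R) :
  admissible q ->
  payoff m q = \int[mu]_wu
    multi_affine h (X (quantile m wu.1 wu.2) wu.1) (quantile m wu.1 wu.2)
      (fun j => q j (quantile m wu.1 wu.2) wu.1).
Proof.
move=> aq; rewrite /payoff (expectation_path_integral (p := m) filF
  (f := fun w t => multi_affine h (X t w) t (fun j => q j t w)))//.
- exact: measurable_multi_affine.
- exact: integrable_payoff.
Qed.

(** Both payoffs are integrals over the same probability space, where the pointwise Lipschitz bound
    applies at each quantile time. *)
Lemma payoff_lipschitz i (m : randomized_stopping F)
    (q q' : opponent i -> R -> Omega -> R) (c : opponent i -> R) :
  admissible q -> admissible q' ->
  (forall j t w, 0 <= t -> `|q j t w - q' j t w| <= c j) ->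
  `|payoff m q - payoff m q'| <=
    \sum_(j : opponent i) fine (influence h i (val j)) * c j.
Proof.
move=> aq aq' qc; rewrite !payoffE// -RintegralB//; last 2 first.
- exact: integrable_payoff.
- exact: integrable_payoff.
set L := \sum_j _; set K := fun wu => _.
have intK : mu.-integrable setT (EFin \o K).
  rewrite (_ : EFin \o K = ((EFin \o (fun wu : Omega * measurableTypeR R =>
    multi_affine h (X (quantile m wu.1 wu.2) wu.1) (quantile m wu.1 wu.2)
      (fun j => q j (quantile m wu.1 wu.2) wu.1))) \-
    (EFin \o (fun wu : Omega * measurableTypeR R =>
    multi_affine h (X (quantile m wu.1 wu.2) wu.1) (quantile m wu.1 wu.2)
      (fun j => q' j (quantile m wu.1 wu.2) wu.1))))%E)//.
  by apply: integrableB => //; exact: integrable_payoff.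
apply: le_trans (le_normr_Rintegral measurableT intK) _.
apply: (@le_trans _ _ (\int[mu]_wu cst L wu)).
  apply: le_Rintegral => //; first exact: integrable_norm.
    exact: integrable_product_cst.
  move=> [w u] _; rewrite /K/=; have q0 := quantile_ge0 m w u.
  apply: le_trans (multi_affine_lipschitz _ q0 _ _ _) _.
  - by move=> j; rewrite finL// (valP j).
  - by move=> k; exact: aq.2.
  - by move=> k; exact: aq'.2.
  apply: ler_sum => j _; rewrite ler_wpM2l ?qc// fine_ge0// influence_ge0//.
rewrite Rintegral_cst// [X in _ * fine X](_ : _ = 1%E) ?mulr1//.
exact: product_probability_setT.
Qed.

End payoff_regularity.

(** * Sums over opponents and integrals over the unit interval *)

Lemma sum_opponent {R : realType} {N : nat} (i : 'I_N) (f : 'I_N -> R) :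
  \sum_(j : opponent i) f (val j) = \sum_(j < N | j != i) f j.
Proof. by rewrite -(big_sub [pred j | j != i] f). Qed.

Lemma lipschitz_integrable01 {R : realType} (f : R -> R) (C : R) :
  (forall x y, 0 <= x <= 1 -> 0 <= y <= 1 -> `|f x - f y| <= C * `|x - y|) ->
  lebesgue_measure.-integrable `[0, 1] (EFin \o f).
Proof.
move=> lipf; apply: continuous_compact_integrable; first exact: segment_compact.
apply/subspace_continuousP => x; rewrite /= in_itv/= => x01.
apply/cvgrPdist_le => e e0.
(* [C] may vanish; [|C| + 1] is a Lipschitz constant by which one can divide. *)
have C0 : 0 < `|C| + 1 by rewrite ltr_wpDl.
near=> y.
have y01 : 0 <= y <= 1 by near: y; exact: withinT.
apply: le_trans (lipf _ _ x01 y01) _.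
apply: (@le_trans _ _ ((`|C| + 1) * `|x - y|)).
  by rewrite ler_wpM2r// (le_trans (ler_norm _))// lerDl.
rewrite -ler_pdivlMl// mulrC; near: y.
apply: cvg_within; have eC0 : 0 < e / (`|C| + 1) by rewrite divr_gt0.
by have /cvgrPdist_le /(_ _ eC0) := @cvg_id _ (nbhs x).
Unshelve. all: by end_near. Qed.

(** As [0, 1] has length 1, [D] and [B] are their own integrals, and the pointwise bound is
    integrated. *)
Lemma Rintegral01_close {R : realType} (f : R -> R) (D B : R) :
  lebesgue_measure.-integrable `[0, 1] (EFin \o f) ->
  (forall r, 0 <= r <= 1 -> `|D - f r| <= B) ->
  `|D - \int[lebesgue_measure]_(r in `[0, 1]) f r| <= B.
Proof.
move=> intf fB.
have mu01 : lebesgue_measure (`[(0 : R), 1])%classic = 1%E.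
  by rewrite lebesgue_measure_itv/= lte_fin ltr01 sube0.
have cstE (c : R) : \int[lebesgue_measure]_(r in `[(0:R), 1]) c = c.
  by rewrite Rintegral_cst//= mu01 mulr1.
have intc (c : R) : lebesgue_measure.-integrable `[(0 : R), 1] (EFin \o cst c).
  apply: (lipschitz_integrable01 (C := 0)) => x y _ _.
  by rewrite subrr normr0 mul0r.
rewrite -[X in `|X - _|]cstE -[leRHS]cstE -RintegralB//; last exact: intc.
have intDf : lebesgue_measure.-integrable `[(0 : R), 1] (EFin \o (fun r => D - f r)).
  rewrite (_ : EFin \o _ = ((EFin \o cst D) \- (EFin \o f))%E)//.
  by apply: integrableB => //; exact: intc.
apply: le_trans (le_normr_Rintegral _ intDf) _ => //.
apply: le_Rintegral => //; [exact: integrable_norm|exact: intc].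
Qed.

(** * Comparison of the potential with the payoffs *)

Section potential_bound.
Context {R : realType} {N n : nat}.
Context {dis : measure_display} {Omega : measurableType dis}.
Context (P : probability Omega R) {F : R -> set (set Omega)}.
Context (X : R -> Omega -> 'rV[R]_n) (h : reward R N n).
Context (z : 'I_N -> randomized_stopping F).
Hypotheses (filF : filtration F) (contX : continuous_process X).
Hypotheses (genX : generated_by P F X) (mh : measurable_reward h).
Hypothesis intR : integrable_reward P F X h.
Hypothesis finL : forall i j : 'I_N, j != i -> influence h i j \is a fin_num.

Implicit Types (p : 'I_N -> randomized_stopping F) (i k : 'I_N) (r : R).

Local Notation L i j := (fine (influence h i j)).
Local Notation V := (payoff P X h).

Definition opponents p k : opponent k -> R -> Omega -> R :=
  fun j => p (val j).

Definition interpolate p r k : opponent k -> R -> Omega -> R :=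
  fun j t w => z (val j) t w + r * (p (val j) t w - z (val j) t w).

Lemma measurable_rs_process (m : randomized_stopping F) :
  measurable_fun setT (fun wt : Omega * R => m (Num.max 0 wt.2) wt.1).
Proof.
apply: measurable_right_continuous_process => [t|w t]; first exact: measurable_rs.
exact: (rs_cadlag m w).1.
Qed.

Lemma admissible_opponents p k : admissible (opponents p (k := k)).
Proof.
by split => [j|j t w t0]; [exact: measurable_rs_process|exact: rs_itv].
Qed.

Lemma admissible_interpolate p r k : 0 <= r <= 1 ->
  admissible (interpolate p r (k := k)).
Proof.
move=> /andP[r0 r1]; split => [j|j t w t0].
  apply: measurable_funD; first exact: measurable_rs_process.
  apply: measurable_funM => //.
  by apply: measurable_funB; exact: measurable_rs_process.
have /andP[z0 z1] := rs_itv (z (val j)) w t0.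
have /andP[p0 p1] := rs_itv (p (val j)) w t0.
by rewrite /interpolate; apply/andP; split; nra.
Qed.

Lemma rs_dist (m m' : randomized_stopping F) t w : 0 <= t -> `|m t w - m' t w| <= 1.
Proof.
move=> t0; have /andP[? ?] := rs_itv m w t0.
by have /andP[? ?] := rs_itv m' w t0; rewrite ler_norml; apply/andP; split; lra.
Qed.

(** The integrand of the potential at [r], with the integral against the signed measure split into
    two payoffs. *)
Definition slope p r : R :=
  \sum_(k < N) (V (p k) (interpolate p r (k := k)) - V (z k) (interpolate p r (k := k))).

Lemma potential_candidateE p :
  potential_candidate P X h z p = \int[lebesgue_measure]_(r in `[0, 1]) slope p r.
Proof.
apply: eq_Rintegral => r; rewrite inE/= in_itv/= => r01; apply: eq_bigr => k _.
rewrite -(payoffB filF contX genX mh intR finL)//.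
exact: admissible_interpolate.
Qed.

(** Since [p] and [z] differ by at most 1, each payoff is Lipschitz in [r]; every player contributes
    two of them, hence the factor 2 in the constant. *)
Lemma integrable_slope p :
  lebesgue_measure.-integrable `[0, 1] (EFin \o slope p).
Proof.
apply: (lipschitz_integrable01
  (C := \sum_(k < N) ((\sum_(j : opponent k) L k (val j)) *+ 2))) => r r' r01 r'01.
rewrite /slope -sumrB (le_trans (ler_norm_sum _ _ _))// mulr_suml.
apply: ler_sum => k _; rewrite mulr2n mulrDl.
have lip (m : randomized_stopping F) :
    `|V m (interpolate p r (k := k)) - V m (interpolate p r' (k := k))| <=
    (\sum_(j : opponent k) L k (val j)) * `|r - r'|.
  rewrite mulr_suml.
  apply: le_trans (payoff_lipschitz filF contX genX mh intR finL
    (c := fun=> `|r - r'|) m (admissible_interpolate p k r01)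
    (admissible_interpolate p k r'01) _) _; last exact: lexx.
  move=> j t w t0.
  rewrite /interpolate opprD addrACA subrr add0r -mulrBl normrM ler_piMr//.
  exact: rs_dist.
apply: le_trans (lerD (lip (p k)) (lip (z k))).
set a := V _ _; set b := V _ _; set c := V _ _; set d := V _ _.
have -> : a - b - (c - d) = (a - c) - (b - d) by ring.
exact: ler_normB.
Qed.

Lemma slope_deviation i p (s : randomized_stopping F) r : 0 <= r <= 1 ->
  `|(randomized_payoff P X h i (deviate i s p) - randomized_payoff P X h i p) -
    (slope (deviate i s p) r - slope p r)| <=
  2 * \sum_(j < N | j != i) (L i j + L j i).
Proof.
move=> r01; set p' := deviate i s p.
have p'i : p' i = s by rewrite /p' /deviate eqxx.
have p'k k : k != i -> p' k = p k by rewrite /p' /deviate => /negbTE ->.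
have pE : opponents p' (k := i) = opponents p (k := i).
  by apply/funext => j; rewrite /opponents p'k// (valP j).
have QE : interpolate p' r (k := i) = interpolate p r (k := i).
  by apply/funext => j; rewrite /interpolate p'k// (valP j).
have -> : randomized_payoff P X h i p' = V s (opponents p (k := i)).
  by rewrite -pE -p'i.
have -> : randomized_payoff P X h i p = V (p i) (opponents p (k := i)) by [].
(* Passing from [p] to the interpolation moves each coordinate by [(1 - r) (p - z)], of modulus at
   most 1. *)
have own (m : randomized_stopping F) :
    `|V m (opponents p (k := i)) - V m (interpolate p r (k := i))| <=
    \sum_(j < N | j != i) L i j.
  rewrite -sum_opponent.
  apply: le_trans (payoff_lipschitz filF contX genX mh intR finL
    (c := fun=> 1) m (admissible_opponents p i) (admissible_interpolate _ _ r01) _) _.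
    move=> j t w t0; rewrite /opponents /interpolate.
    set a := p _ _ _; set b := z _ _ _.
    have -> : a - (b + r * (a - b)) = (1 - r) * (a - b) by ring.
    rewrite normrM mulr_ile1// ?rs_dist//.
    by case/andP: r01 => r0 r1; rewrite ger0_norm ?subr_ge0// lerBlDr lerDl.
  by apply: ler_sum => j _; rewrite mulr1.
(* Only coordinate [i] of the interpolation changes, by [r] times the difference of two strategies,
   again at most 1 in modulus. *)
have other k (m : randomized_stopping F) : k != i ->
    `|V m (interpolate p' r (k := k)) - V m (interpolate p r (k := k))| <= L k i.
  move=> ki.
  apply: le_trans (payoff_lipschitz filF contX genX mh intR finL
    (c := fun j => (val j == i)%:R) m (admissible_interpolate _ _ r01)
    (admissible_interpolate _ _ r01) _) _.
    move=> j t w t0; rewrite /interpolate opprD addrACA subrr add0r -mulrBr.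
    have [ji|ji] := eqVneq (val j) i; last first.
      by rewrite p'k// subrr mulr0 normr0.
    set a := p' _ _ _; set b := p _ _ _; set c := z _ _ _.
    have -> : a - c - (b - c) = a - b by ring.
    rewrite normrM mulr_ile1// ?rs_dist//.
    by case/andP: r01 => r0 r1; rewrite ger0_norm.
  rewrite (sum_opponent k (fun j => L k j * (j == i)%:R)) (bigD1 i) 1?eq_sym//=.
  rewrite eqxx mulr1 big1 ?addr0// => j /andP[_ /negbTE ->].
  by rewrite mulr0.
rewrite /slope (bigD1 i)//= [X in _ - (_ - X)](bigD1 i)//= QE p'i.
under eq_bigr => k ki do rewrite p'k//.
set S1 := \sum_(k < N | k != i) _; set S2 := \sum_(k < N | k != i) _.
have S12 : `|S1 - S2| <= 2 * \sum_(j < N | j != i) L j i.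
  rewrite -sumrB (le_trans (ler_norm_sum _ _ _))// mulr_sumr.
  apply: ler_sum => k ki; rewrite mulr_natl mulr2n.
  apply: le_trans (lerD (other k (p k) ki) (other k (z k) ki)).
  set a := V _ _; set b := V _ _; set c := V _ _; set d := V _ _.
  have -> : a - b - (c - d) = (a - c) - (b - d) by ring.
  exact: ler_normB.
rewrite big_split/= mulrDr.
have := own s; have := own (p i).
set a := V s _; set b := V (p i) _; set c := V s _; set d := V (p i) _.
set e := V (z i) _.
move=> H1 H2.
(* The base payoff [e] of player [i] cancels, since the interpolation that [i] faces is the same
   before and after the deviation. What remains is two [own] differences and [S1 - S2]. *)
have -> : a - b - (c - e + S1 - (d - e + S2)) = ((a - c) - (b - d)) - (S1 - S2) by ring.
apply: le_trans (ler_normB _ _) (lerD _ S12).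
apply: le_trans (ler_normB _ _) _.
by rewrite mulr_natl mulr2n; exact: (lerD H2 H1).
Qed.

Lemma alpha_potential_influence (M : R) :
  (forall i, \sum_(j < N | j != i) (L i j + L j i) <= M) ->
  alpha_potential (randomized_payoff P X h) (potential_candidate P X h z) (2 * M).
Proof.
move=> LM i p s; rewrite !potential_candidateE.
rewrite -RintegralB//; [|exact: integrable_slope..].
(* The payoff change does not depend on [r], and the slope change is close to it uniformly in
   [r]. *)
apply: Rintegral01_close.
  rewrite (_ : EFin \o _ =
    ((EFin \o slope (deviate i s p)) \- (EFin \o slope p))%E)//.
  by apply: integrableB => //; exact: integrable_slope.
move=> r r01; apply: le_trans (slope_deviation _ _ _ r01) _.
by rewrite ler_pM2l.
Qed.

End potential_bound.

(** * The bound on the smallest constant *)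

Theorem proposition3p5 (R : realType) (N n : nat)
    (dis : measure_display) (Omega : measurableType dis)
    (P : probability Omega R) (F : R -> set (set Omega))
    (X : R -> Omega -> 'rV[R]_n) (h : reward R N n)
    (z : 'I_N -> randomized_stopping F) :
  (2 <= N)%N ->
  filtration F ->
  usual_conditions P F ->
  continuous_process X ->
  generated_by P F X ->
  measurable_reward h ->
  integrable_reward P F X h ->
  (forall i, deterministic (z i)) ->
  (smallest_alpha (randomized_payoff P X h) (potential_candidate P X h z)
     <= 2%:E * \big[maxe/-oo]_(i < N)
                 \sum_(j < N | j != i) (influence h i j + influence h j i))%E.
Proof.
move=> N2 filF _ contX genX mh intR _.
set f := fun i : 'I_N => (\sum_(j < N | j != i) (influence h i j + influence h j i))%E.
set M := \big[maxe/-oo%E]_(i < N) f i.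
have f_ge0 i : (0 <= f i)%E.
  by apply: sume_ge0 => j _; rewrite adde_ge0// influence_ge0.
have fM i : (f i <= M)%E by exact: le_bigmax.
(* Some player exists, so the maximum does not keep its initial value [-oo]. *)
have M_ge0 : (0 <= M)%E by apply: le_trans (fM (Ordinal (ltnW N2))).
have [Moo|Moo] := eqVneq M +oo%E.
  by rewrite Moo gt0_muley ?leey// lte_fin.
have finM : M \is a fin_num by rewrite ge0_fin_numE// ltey.
(* Each influence is one of the nonnegative terms of [f i], which the finite [M] dominates. *)
have finL (i j : 'I_N) : j != i -> influence h i j \is a fin_num.
  move=> ji; rewrite ge0_fin_numE ?influence_ge0//.
  apply: (@le_lt_trans _ _ (f i)); last first.
    by apply: (le_lt_trans (fM i)); rewrite ltey.
  rewrite /f (bigD1 j)//= -addeA leeDl// adde_ge0 ?influence_ge0//.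
  by apply: sume_ge0 => k _; rewrite adde_ge0// influence_ge0.
rewrite -(fineK finM) -EFinM; apply: ereal_inf_lbound.
exists (2 * fine M) => //; apply: alpha_potential_influence => // i.
rewrite -lee_fin fineK// -sumEFin; apply: le_trans (fM i).
by apply: lee_sum => j ji; rewrite EFinD !fineK// finL// eq_sym.
Qed.
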